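(* Let $m\ge2$ and let $Y_1,\dots,Y_m\in\mathbb{R}^{2n\times n}$ be frames. Then: (i) For arbitrary nonsingular matrices $C_1,\dots,C_m\in\mathbb{R}^{n\times n}$, $$\mu_c^{\pm}(Y_1,\dots,Y_m)=\mu_c^{\pm}(Y_1C_1,\dots,Y_mC_m),\qquad \nu_c^{\pm}(Y_1,\dots,Y_m)=\nu_c^{\pm}(Y_1C_1,\dots,Y_mC_m).$$ (ii) $\mu_c^{\pm}$ is invariant under cyclic permutations: $$\mu_c^{\pm}(Y_1,Y_2,\dots,Y_m)=\mu_c^{\pm}(Y_m,Y_1,Y_2,\dots,Y_{m-1})=\dots=\mu_c^{\pm}(Y_2,Y_3,\dots,Y_m,Y_1).$$ (iii) $$\mu_c^{\pm}(Y_1,Y_2,\dots,Y_m)=\mu_c^{\mp}(Y_m,Y_{m-1},\dots,Y_1),\qquad \nu_c^{\pm}(Y_1,Y_2,\dots,Y_m)=\nu_c^{\mp}(Y_m,Y_{m-1},\dots,Y_1).$$ (iv) $$\mu_c^{-}(Y_1,\dots,Y_m)+\mu_c^{+}(Y_1,\dots,Y_m)=\sum_{j=1}^{m-1}\operatorname{rank}w(Y_j,Y_{j+1})+\operatorname{rank}w(Y_m,Y_1),$$ $$\nu_c^{-}(Y_1,\dots,Y_m)+\nu_c^{+}(Y_1,\dots,Y_m)=\sum_{j=1}^{m-1}\operatorname{rank}w(Y_j,Y_{j+1})-\operatorname{rank}w(Y_m,Y_1).$$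
   Context: $\mathcal{J}=\begin{pmatrix}0&I\\-I&0\end{pmatrix}\in\mathbb{R}^{2n\times 2n}$ and $w(Y,\hat Y)=Y^T\mathcal{J}\hat Y$. For a real symmetric matrix $A$, $\operatorname{ind}A$ is the number of negative eigenvalues counted with multiplicity. $A^{\dagger}$ is the Moore–Penrose pseudoinverse. A frame is a real $2n\times n$ matrix $Y$ with $w(Y,Y)=0$ and $\operatorname{rank}Y=n$. For frames $Y=\binom{X}{U}$, $\hat Y=\binom{\hat X}{\hat U}$ ($n\times n$ blocks) put $\mathcal M=(I-X^{\dagger}X)\,w(Y,\hat Y)$, $\mathcal T=I-\mathcal M^{\dagger}\mathcal M$, $\mathcal P=\mathcal T\,w(Y,\hat Y)^T X^{\dagger}\hat X\,\mathcal T$ (symmetric), and define the comparative index and dual comparative index $\mu(Y,\hat Y)=\operatorname{rank}\mathcal M+\operatorname{ind}\mathcal P$, $\mu^*(Y,\hat Y)=\operatorname{rank}\mathcal M+\operatorname{ind}(-\mathcal P)$. Cyclic sums, $m\ge2$: $\mu_c^-(Y_1,\dots,Y_m)=\sum_{k=1}^{m-1}\mu(Y_k,Y_{k+1})+\mu(Y_m,Y_1)$, $\mu_c^+(Y_1,\dots,Y_m)=\sum_{k=1}^{m-1}\mu^*(Y_k,Y_{k+1})+\mu^*(Y_m,Y_1)$, $\nu_c^-(Y_1,\dots,Y_m)=\sum_{k=1}^{m-1}\mu(Y_k,Y_{k+1})-\mu(Y_1,Y_m)$, $\nu_c^+(Y_1,\dots,Y_m)=\sum_{k=1}^{m-1}\mu^*(Y_k,Y_{k+1})-\mu^*(Y_1,Y_m)$.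 *)

(* Defs.v *)
From mathcomp Require Import all_boot all_order all_algebra.
From mathcomp Require Import reals.
From mathcomp.real_closed Require Import polyrcf.

Set Implicit Arguments.
Unset Strict Implicit.
Unset Printing Implicit Defensive.

Import Order.TTheory GRing.Theory Num.Theory.
Local Open Scope ring_scope.

(* The four Penrose equations. *)
Definition is_MPinv (R : rcfType) (m n : nat) (A : 'M[R]_(m, n))
    (B : 'M[R]_(n, m)) : bool :=
  [&& A *m B *m A == A, B *m A *m B == B,
      (A *m B)^T == A *m B & (B *m A)^T == B *m A].

Lemma gram_unitmx (R : rcfType) (r n : nat) (C : 'M[R]_(r, n)) :
  row_free C -> C *m C^T \in unitmx.
Proof.
move=> fC; rewrite -row_free_unit -kermx_eq0; apply/eqP/row_matrixP => i.
rewrite row0; set v := row i _.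
have vCC : v *m (C *m C^T) = 0 by rewrite -row_mul mulmx_ker row0.
apply: (row_free_inj fC); rewrite mul0mx; set u := v *m C.
have uu : (u *m u^T) 0 0 = 0.
  by rewrite /u trmx_mul mulmxA -(mulmxA v) vCC mul0mx mxE.
apply/rowP => j; rewrite [RHS]mxE.
move: uu; rewrite mxE => /eqP; rewrite psumr_eq0 => [/allP /(_ j)|k _].
  by rewrite mem_index_enum [_^T _ _]mxE => /(_ isT); rewrite /= mulf_eq0 orbb => /eqP.
by rewrite [_^T _ _]mxE -expr2 sqr_ge0.
Qed.

Lemma MPinv_exists (R : rcfType) (m n : nat) (A : 'M[R]_(m, n)) :
  exists B : 'M[R]_(n, m), is_MPinv A B.
Proof.
have [r [F [C [CU FU AE]]]] : exists r (F : 'M[R]_(m, r)) (C : 'M[R]_(r, n)),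
    [/\ C *m C^T \in unitmx, F^T *m F \in unitmx & A = F *m C].
  exists (\rank A), (col_base A), (row_base A); split.
  - exact/gram_unitmx/row_base_free.
  - rewrite -{2}[col_base A]trmxK; apply: gram_unitmx.
    by rewrite /row_free mxrank_tr; have := col_base_full A.
  - by rewrite mulmx_base.
set H := C^T *m invmx (C *m C^T); set G := invmx (F^T *m F) *m F^T.
have CH : C *m H = 1%:M by rewrite mulmxA mulmxV.
have GF : G *m F = 1%:M by rewrite -mulmxA mulVmx.
have AB : A *m (H *m G) = F *m G.
  by rewrite AE mulmxA -(mulmxA F) CH mulmx1.
have BA : H *m G *m A = H *m C.
  by rewrite AE mulmxA -(mulmxA H) GF mulmx1.
exists (H *m G); apply/and4P; rewrite AB BA; split; apply/eqP.
- by rewrite AE mulmxA -(mulmxA F) GF mulmx1.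
- by rewrite mulmxA -(mulmxA H) CH mulmx1.
- by rewrite /G !trmx_mul trmxK trmx_inv trmx_mul trmxK mulmxA.
- by rewrite /H !trmx_mul trmxK trmx_inv trmx_mul trmxK mulmxA.
Qed.

Definition MPinv (R : rcfType) (m n : nat) (A : 'M[R]_(m, n)) : 'M[R]_(n, m) :=
  xchoose (MPinv_exists A).

Lemma MPinvP (R : rcfType) (m n : nat) (A : 'M[R]_(m, n)) :
  is_MPinv A (MPinv A).
Proof. exact: xchooseP. Qed.

Lemma is_MPinv_uniq (R : rcfType) (m n : nat) (A : 'M[R]_(m, n))
    (B B' : 'M[R]_(n, m)) : is_MPinv A B -> is_MPinv A B' -> B = B'.
Proof.
case/and4P=> /eqP A1 /eqP A2 /eqP A3 /eqP A4.
case/and4P=> /eqP B1 /eqP B2 /eqP B3 /eqP B4.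
have E1 : A *m B = A *m B'.
  by rewrite -A3 -{1}B1 -mulmxA trmx_mul A3 B3 mulmxA A1.
have E2 : B *m A = B' *m A.
  rewrite -A4 -{1}B1 -(mulmxA A) (mulmxA B) trmx_mul A4 B4.
  by rewrite -!mulmxA (mulmxA A) A1.
by rewrite -A2 E2 -mulmxA E1 mulmxA B2.
Qed.

(* rootsR lists the distinct real roots of the (nonzero) characteristic
   polynomial, and mup is the multiplicity of a root. *)
Definition ind (R : rcfType) (n : nat) (A : 'M[R]_n) : nat :=
  (\sum_(x <- rootsR (char_poly A) | (x < 0)%R) mup x (char_poly A))%N.

Section ComparativeIndex.
Variables (R : rcfType) (n : nat).
Implicit Types (Y : 'M[R]_(n + n, n)) (s : seq 'M[R]_(n + n, n)).

Definition symJ : 'M[R]_(n + n) := block_mx 0 1%:M (- 1%:M) 0.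

Definition wronsk Y Y' : 'M[R]_n := Y^T *m symJ *m Y'.

Definition frame Y : Prop := wronsk Y Y = 0 /\ \rank Y = n.

(* For Y = (X; U), X is usubmx Y. *)
Definition ciM Y Y' : 'M[R]_n :=
  (1%:M - MPinv (usubmx Y) *m usubmx Y) *m wronsk Y Y'.

Definition ciT Y Y' : 'M[R]_n := 1%:M - MPinv (ciM Y Y') *m ciM Y Y'.

Definition ciP Y Y' : 'M[R]_n :=
  ciT Y Y' *m (wronsk Y Y')^T *m MPinv (usubmx Y) *m usubmx Y' *m ciT Y Y'.

Definition mu Y Y' : nat := (\rank (ciM Y Y') + ind (ciP Y Y'))%N.

Definition mu_dual Y Y' : nat := (\rank (ciM Y Y') + ind (- ciP Y Y'))%N.

(* The list (Y_1, ..., Y_m) is indexed from 0, so Y_k is s`_k.-1 and Y_m is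
   s`_(size s).-1; the values are integers because of the subtraction in nu. *)
Definition mu_c_minus s : int :=
  \sum_(0 <= k < (size s).-1) (mu s`_k s`_k.+1)%:Z
  + (mu s`_(size s).-1 s`_0)%:Z.

Definition mu_c_plus s : int :=
  \sum_(0 <= k < (size s).-1) (mu_dual s`_k s`_k.+1)%:Z
  + (mu_dual s`_(size s).-1 s`_0)%:Z.

Definition nu_c_minus s : int :=
  \sum_(0 <= k < (size s).-1) (mu s`_k s`_k.+1)%:Z
  - (mu s`_0 s`_(size s).-1)%:Z.

Definition nu_c_plus s : int :=
  \sum_(0 <= k < (size s).-1) (mu_dual s`_k s`_k.+1)%:Z
  - (mu_dual s`_0 s`_(size s).-1)%:Z.

End ComparativeIndex.

(* Main.v *)
(* Write r = rank X and r' = rank X'.  A vector c lies in the kernel of M(Y, Y')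
   iff X' c = X a for some a, and then P(c, c) = w(Y a, Y' c).  So P is a form on
   the pairs (a, c) with X a = X' c.  This description is insensitive to the
   change of bases Y C, and exchanging Y and Y' changes the sign of the form,
   hence ind P is invariant under the former and ind P(Y, Y') = ind (- P(Y', Y)).
   Moreover rank M(Y, Y') = rank (X X') - r, which is not symmetric; therefore
     mu(Y, Y') = mu*(Y', Y) + r' - r,
     mu(Y, Y') + mu*(Y, Y') = rank w(Y, Y') + r' - r,
   and the differences r' - r telescope in the cyclic sums. *)

Require Import Defs.
From mathcomp Require Import all_boot all_order all_algebra.
From mathcomp Require Import reals zify.
From mathcomp.real_closed Require Import polyrcf complex.

Set Implicit Arguments.
Unset Strict Implicit.
Unset Printing Implicit Defensive.

Import Order.TTheory GRing.Theory Num.Theory.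
Local Open Scope ring_scope.

(** * Inertia of real symmetric matrices: spectral theorem and Sylvester's law *)

Section Inertia.
Local Open Scope sesquilinear_scope.
Variable R : rcfType.
Local Notation toC := (real_complex R).

Lemma char_poly_similar (F : fieldType) n (P A D : 'M[F]_n) :
  P \in unitmx -> P *m A = D *m P -> char_poly A = char_poly D.
Proof.
move=> Pu PA; set Px := map_mx polyC P.
have PxE : Px *m char_poly_mx A = char_poly_mx D *m Px.
  by rewrite mulmxBr mulmxBl scalar_mxC -!map_mxM PA.
have: \det Px * char_poly A = \det Px * char_poly D.
  by rewrite -[LHS]det_mulmx PxE det_mulmx mulrC.
apply: mulfI; rewrite det_map_mx polyC_eq0.
by move: Pu; rewrite unitmxE unitfE.
Qed.

Lemma ind_char_poly n (A : 'M[R]_n) (r : 'rV[R]_n) :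
  char_poly A = \prod_i ('X - (r 0 i)%:P) -> ind A = #|[pred i | r 0 i < 0]|.
Proof.
move=> chA; set s := [seq r 0 i | i <- index_enum 'I_n].
have chs : char_poly A = \prod_(x <- s) ('X - x%:P).
  by rewrite chA big_map.
have ch0 : char_poly A != 0 by rewrite monic_neq0 ?char_poly_monic.
have rs : perm_eq (rootsR (char_poly A)) (undup s).
  apply: uniq_perm; rewrite ?undup_uniq ?uniq_roots // => x.
  rewrite mem_undup -(roots_on_rootsR ch0) in_itv /=.
  by rewrite chs root_prod_XsubC.
rewrite /ind (perm_big _ rs) /=.
under eq_bigr => x _ do rewrite chs mu_prod_XsubC.
transitivity (\sum_(x <- s | (x < 0)%R) 1)%N; last first.
  by rewrite big_map sum1_card.
(* Adding multiplicities over the distinct roots amounts to adding 1 over [s] itself. *)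
rewrite -[RHS]big_undup_iterop_count; apply: eq_bigr => x _.
by rewrite Monoid.iteropE iter_addn mul1n addn0.
Qed.

(** Over [R[i]] the matrix is hermitian, hence unitarily diagonalizable with real spectrum; only [P]
    stays complex. *)
Lemma symmetric_spectral n (A : 'M[R]_n) : A^T = A ->
  exists (P : 'M[R[i]]_n) (r : 'rV[R]_n), P \is unitarymx /\
    map_mx toC A = P^t* *m diag_mx (map_mx toC r) *m P.
Proof.
move=> sA; set B := map_mx toC A.
have BH : B \is hermsymmx.
  apply: realsym_hermsym.
    by apply/is_hermitianmxP; rewrite expr0 scale1r map_mx_id // map_trmx sA.
  by apply/mxOverP => i j; rewrite mxE complex_real.
exists (spectralmx B), (map_mx (@complex.Re R) (spectral_diag B)).
split; first exact: spectral_unitarymx.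
rewrite -map_mx_comp [map_mx _ (spectral_diag B)]map_mx_id_in.
  rewrite -invmx_unitary ?spectral_unitarymx //.
  exact/orthomx_spectralP/hermitian_normalmx.
move=> i j; rewrite /= RRe_real //.
by have /mxOverP := hermitian_spectral_diag_real BH; apply.
Qed.

Lemma char_poly_diag (F : comNzRingType) n (d : 'rV[F]_n) :
  char_poly (diag_mx d) = \prod_i ('X - (d 0 i)%:P).
Proof.
rewrite char_poly_trig ?diag_mx_is_trig //.
by apply: eq_bigr => i _; rewrite mxE eqxx mulr1n.
Qed.

Lemma ind_spectral n (A : 'M[R]_n) (P : 'M[R[i]]_n) (r : 'rV[R]_n) :
    P \is unitarymx ->
    map_mx toC A = P^t* *m diag_mx (map_mx toC r) *m P ->
  ind A = #|[pred i | r 0 i < 0]|.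
Proof.
move=> Pu AE; apply: ind_char_poly; rewrite -char_poly_diag.
apply: (@map_poly_inj _ _ toC); rewrite /= !map_char_poly map_diag_mx.
apply: (char_poly_similar (unitarymx_unit Pu)).
by rewrite AE !mulmxA (unitarymxP Pu) mul1mx.
Qed.

Lemma rank_diag_mx (F : fieldType) n (d : 'rV[F]_n) :
  \rank (diag_mx d) = #|[pred i | d 0 i != 0]|.
Proof.
set I := [pred i | d 0 i != 0].
pose S : 'M[F]_(#|I|, n) := rowsub (@enum_val _ I) 1%:M.
have SS : S *m S^T = 1%:M.
  apply/matrixP => i j; rewrite mul_rowsub_mx mul1mx !mxE eq_sym.
  by rewrite (inj_eq enum_val_inj).
have dS : (diag_mx d :=: S)%MS.
  apply/eqmxP/andP; split; apply/row_subP => i.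
    rewrite row_diag_mx; have [->|di] := eqVneq (d 0 i) 0.
      by rewrite scale0r sub0mx.
    apply/scalemx_sub/submxP; exists (delta_mx 0 (enum_rank_in (di : i \in I) i)).
    by rewrite -rowE row_rowsub enum_rankK_in // rowE mulmx1.
  rewrite row_rowsub rowE mulmx1; have := enum_valP i; rewrite inE => di.
  by rewrite -[X in (X <= _)%MS](scalerK di) -row_diag_mx scalemx_sub ?row_sub.
rewrite dS; apply/eqP; rewrite -/(row_free S).
by apply/row_freeP; exists S^T.
Qed.

(** The rank counts the nonzero entries of the spectrum [r], that is, the negative entries of [r]
    and of [-r]; the same [P] diagonalizes [-A]. *)
Lemma rank_ind n (A : 'M[R]_n) : A^T = A -> \rank A = (ind A + ind (- A))%N.
Proof.
move=> sA; have [P [r [Pu AE]]] := symmetric_spectral sA.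
have NAE : map_mx toC (- A) = P^t* *m diag_mx (map_mx toC (- r)) *m P.
  by rewrite !map_mxN AE (raddfN (@diag_mx _ n)) mulmxN mulNmx.
rewrite (ind_spectral Pu AE) (ind_spectral Pu NAE).
have Pun := unitarymx_unit Pu.
rewrite -(mxrank_map toC) AE mxrankMfree ?row_free_unit //.
rewrite -mxrank_tr trmx_mul mxrankMfree ?mxrank_tr; last first.
  by rewrite row_free_unit unitmx_tr -invmx_unitary // unitmx_inv.
rewrite -map_diag_mx mxrank_map rank_diag_mx -cardUI [X in (_ + X)%N]eq_card0 ?addn0.
  by apply: eq_card => i; rewrite !inE mxE oppr_lt0 neq_lt.
move=> i; rewrite !inE mxE oppr_lt0; apply/negP => /andP[/lt_trans/[apply]].
by rewrite ltxx.
Qed.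

Lemma diag_form n (d : 'rV[R]_n) (y : 'rV[R[i]]_n) :
  (y *m diag_mx (map_mx toC d) *m y^t*) 0 0 =
    \sum_i toC (d 0 i) * `|y 0 i| ^+ 2.
Proof.
rewrite mxE; apply: eq_bigr => i _.
rewrite mul_mx_diag !mxE normCK mulrAC mulrC mulrA; congr (_ * _).
Qed.

(* If e had more negative entries than d, some nonzero v supported on the negative
   entries of e would make v S vanish on those of d, so the value of the form at v
   would be both negative and nonnegative. *)
Lemma inertia_le n k (d : 'rV[R]_n) (e : 'rV[R]_k) (S : 'M[R[i]]_(k, n)) :
    S *m diag_mx (map_mx toC d) *m S^t* = diag_mx (map_mx toC e) ->
  (#|[pred j | (e 0 j < 0)%R]| <= #|[pred i | (d 0 i < 0)%R]|)%N.
Proof.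
set I := [pred j | _]; set J := [pred i | _] => SE; rewrite leqNgt; apply/negP => lt.
(* [N] has more rows than columns, hence a nonzero left kernel vector [u]; [v] extends [u] by zero
   outside [I]. *)
pose N := mxsub (@enum_val _ I) (@enum_val _ J) S.
have /rowV0Pn[u /sub_kermxP uN u0]: kermx N != 0.
  rewrite kermx_eq0 /row_free neq_ltn; apply/orP; left.
  exact: leq_ltn_trans (rank_leq_col _) lt.
pose v := u *m rowsub (@enum_val _ I) 1%:M.
have vE j : v 0 (enum_val j) = u 0 j.
  rewrite mxE (bigD1 j) //= !mxE eqxx mulr1 big1 ?addr0 // => l lj.
  by rewrite !mxE (inj_eq enum_val_inj) (negPf lj) mulr0.
have vN j : j \notin I -> v 0 j = 0.
  move=> jI; rewrite mxE big1 // => l _; rewrite !mxE.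
  by case: eqP => [jl|]; rewrite ?mulr0 //; move: jI; rewrite -jl enum_valP.
have yJ i : i \in J -> (v *m S) 0 i = 0.
  move=> iJ; rewrite -mulmxA mul_rowsub_mx mul1mx.
  move/rowP: uN => /(_ (enum_rank_in iJ i)); rewrite [RHS]mxE => <-.
  by rewrite !mxE; apply: eq_bigr => l _; rewrite !mxE enum_rankK_in.
have pos : 0 <= \sum_j toC (e 0 j) * `|v 0 j| ^+ 2.
  rewrite -diag_form -SE !mulmxA -mulmxA -map_mxM -trmx_mul diag_form.
  apply: sumr_ge0 => i _; have [di|di] := ltP (d 0 i) 0.
    by rewrite yJ // normr0 expr0n mulr0.
  by rewrite mulr_ge0 ?exprn_ge0 // ler0c.
have neg j : 0 <= - (toC (e 0 j) * `|v 0 j| ^+ 2).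
  rewrite -mulNr; have [ej|ej] := ltP (e 0 j) 0; last first.
    by rewrite vN ?normr0 ?expr0n ?mulr0 // inE -leNgt.
  by rewrite mulr_ge0 ?exprn_ge0 // -rmorphN ler0c oppr_ge0 ltW.
have: \sum_j - (toC (e 0 j) * `|v 0 j| ^+ 2) == 0.
  by rewrite eq_le sumr_ge0 // sumrN oppr_le0 pos.
rewrite psumr_eq0 // => /allP v0; case/negP: u0; apply/eqP/rowP => j.
rewrite -vE [RHS]mxE; have := v0 (enum_val j); rewrite mem_index_enum => /(_ isT).
rewrite /= oppr_eq0 mulf_eq0 expf_eq0 /= normr_eq0 fmorph_eq0.
by have := enum_valP j; rewrite inE => /lt_eqF -> /= /eqP.
Qed.

(** One half of Sylvester's law, with [L] possibly singular: in spectral coordinates [L] becomes a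
    congruence of diagonal matrices. Congruences in both directions then give equal indices. *)
Lemma ind_congr n k (A : 'M[R]_n) (L : 'M[R]_(n, k)) :
  A^T = A -> (ind (L^T *m A *m L) <= ind A)%N.
Proof.
move=> sA; have sB : (L^T *m A *m L)^T = L^T *m A *m L.
  by rewrite !trmx_mul trmxK sA mulmxA.
have [P [r [Pu AE]]] := symmetric_spectral sA.
have [Q [e [Qu BE]]] := symmetric_spectral sB.
rewrite (ind_spectral Pu AE) (ind_spectral Qu BE).
set K := map_mx toC L.
have KE : K^t* = map_mx toC L^T.
  by apply/matrixP => i j; rewrite !mxE conj_Creal ?complex_real.
apply: (@inertia_le _ _ r e (Q *m K^t* *m P^t*)).
have -> : (Q *m K^t* *m P^t*)^t* = P *m K *m Q^t*.
  by rewrite !trmx_mul !map_mxM !trmxCK mulmxA.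
transitivity (Q *m (K^t* *m map_mx toC A *m K) *m Q^t*).
  by rewrite AE !mulmxA.
rewrite KE -!map_mxM BE !mulmxA (unitarymxP Qu) mul1mx -mulmxA.
by rewrite (unitarymxP Qu) mulmx1.
Qed.
End Inertia.

(* Otherwise failing conversion checks unfold xchoose and rootsR and diverge. *)
#[local] Opaque MPinv ind.

(** * Orthogonal projectors onto kernels, and rank counts *)

Section KernelProjector.
Variables (R : rcfType) (m n : nat) (A : 'M[R]_(m, n)).

(** The orthogonal projector onto the column kernel of [A]: the first factor of [ciM] for [A = X],
    and [ciT] for [A = ciM Y Y']. *)
Let E := 1%:M - MPinv A *m A.

Lemma mulmx_ker_proj : A *m E = 0.
Proof.
have /and4P[/eqP AB _ _ _] := MPinvP A.
by rewrite mulmxBr mulmx1 mulmxA AB subrr.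
Qed.

Lemma ker_proj_sym : E^T = E.
Proof.
by have /and4P[_ _ _ /eqP AB] := MPinvP A; rewrite linearB /= AB trmx1.
Qed.

Lemma ker_proj_mul_tr : E *m A^T = 0.
Proof. by rewrite -ker_proj_sym -trmx_mul mulmx_ker_proj trmx0. Qed.

Lemma ker_proj_id k (G : 'M_(n, k)) : A *m G = 0 -> E *m G = G.
Proof. by move=> AG; rewrite mulmxBl mul1mx -mulmxA AG mulmx0 subr0. Qed.

Lemma ker_proj_eqmx : (E :=: kermx A^T)%MS.
Proof.
apply/eqmxP/andP; split; first by apply/sub_kermxP/ker_proj_mul_tr.
have K0 : A *m (kermx A^T)^T = 0.
  by apply: trmx_inj; rewrite trmx_mul trmxK mulmx_ker trmx0.
rewrite -[kermx A^T]trmxK -(ker_proj_id K0) trmx_mul ker_proj_sym.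
exact: submxMl.
Qed.

Lemma rank_ker_proj : \rank E = (n - \rank A)%N.
Proof. by rewrite ker_proj_eqmx mxrank_ker mxrank_tr. Qed.

End KernelProjector.

(** The row space of [T] contains the left kernel of [W], so [T *m W] has rank [\rank T] minus the
    dimension of that kernel. *)
Lemma rank_ker_mul (F : fieldType) (m n p q : nat) (T : 'M[F]_(p, m))
    (W : 'M[F]_(m, n)) (E : 'M[F]_(n, q)) :
  (T :=: kermx (W *m E))%MS -> \rank W = (\rank (W *m E) + \rank (T *m W))%N.
Proof.
move=> TE; have := mxrank_mul_ker T W.
have -> : \rank (T :&: kermx W)%MS = \rank (kermx W).
  apply: eqmx_rank; apply/eqmxP; apply/capmx_idPr; rewrite TE.
  by apply/sub_kermxP; rewrite mulmxA mulmx_ker mul0mx.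
rewrite TE !mxrank_ker; have := rank_leq_row W; have := mxrankM_maxl W E.
lia.
Qed.

(** * The kernel of M, the form P, and the comparative index of two frames *)

Section ComparativeForm.
Variables (R : rcfType) (n : nat).
Implicit Types Y : 'M[R]_(n + n, n).

Lemma wronskE Y Y' :
  wronsk Y Y' = (usubmx Y)^T *m dsubmx Y' - (dsubmx Y)^T *m usubmx Y'.
Proof.
rewrite /wronsk /symJ -{1}[Y]vsubmxK -{1}[Y']vsubmxK tr_col_mx.
rewrite mul_row_block mul_row_col !mulmx0 !mulmxN !mulmx1 add0r addr0 mulNmx.
by rewrite addrC.
Qed.

Lemma wronsk_tr Y Y' : (wronsk Y Y')^T = - wronsk Y' Y.
Proof. by rewrite !wronskE linearB /= !trmx_mul !trmxK opprB. Qed.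

Lemma wronskM Y Y' C C' : wronsk (Y *m C) (Y' *m C') = C^T *m wronsk Y Y' *m C'.
Proof. by rewrite /wronsk trmx_mul !mulmxA. Qed.

Lemma frame_sym Y : frame Y ->
  (usubmx Y)^T *m dsubmx Y = (dsubmx Y)^T *m usubmx Y.
Proof. by case=> /eqP; rewrite wronskE subr_eq0 => /eqP. Qed.

Lemma frameM Y C : C \in unitmx -> frame Y -> frame (Y *m C).
Proof.
move=> Cu [wY rY]; split; first by rewrite wronskM wY mulmx0 mul0mx.
by rewrite mxrankMfree ?row_free_unit.
Qed.

Lemma ciME Y Y' : ciM Y Y' =
  - ((1%:M - MPinv (usubmx Y) *m usubmx Y) *m (dsubmx Y)^T *m usubmx Y').
Proof.
by rewrite /ciM wronskE mulmxBr mulmxA ker_proj_mul_tr mul0mx sub0r mulmxA.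
Qed.

(** Inclusion follows from the symmetry of [X^T U]. Dimensions agree because [E Y^T = (0, E U^T)]
    and [Y^T] has full row rank, so [E U^T] has at least the rank [n - rank X] of [E]. *)
Lemma frame_ker_eqmx Y : frame Y ->
  ((1%:M - MPinv (usubmx Y) *m usubmx Y) *m (dsubmx Y)^T :=: kermx (usubmx Y))%MS.
Proof.
move=> fY; set E := 1%:M - _; set D := E *m _.
have DX : (D <= kermx (usubmx Y))%MS.
  apply/sub_kermxP.
  by rewrite /D -mulmxA -frame_sym // mulmxA ker_proj_mul_tr mul0mx.
apply/eqmxP; rewrite -(geq_leqif (mxrank_leqif_eq DX)) mxrank_ker.
rewrite -rank_ker_proj -/E.
have fYT : row_free Y^T by case: fY => _ rY; rewrite /row_free mxrank_tr rY.
have EY : E *m Y^T = D *m row_mx 0 1%:M.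
  rewrite -[Y in Y^T]vsubmxK tr_col_mx !mul_mx_row ker_proj_mul_tr.
  by rewrite mulmx0 mulmx1.
by rewrite -(mxrankMfree E fYT) EY mxrankM_maxl.
Qed.

(** [M] has the rank of [kermx X *m X'], which loses the common left kernel of [X] and [X'], a
    quantity symmetric in the two frames. *)
Lemma rank_ciM Y Y' : frame Y ->
  (\rank (ciM Y Y') + \rank (usubmx Y)
    + \rank (kermx (usubmx Y) :&: kermx (usubmx Y'))%MS)%N = n.
Proof.
move=> fY; rewrite ciME mxrank_opp (eqmxMr _ (frame_ker_eqmx fY)).
rewrite addnAC mxrank_mul_ker mxrank_ker subnK //; exact: rank_leq_row.
Qed.

Lemma rank_ciM_sym Y Y' : frame Y -> frame Y' ->
  (\rank (ciM Y Y') + \rank (usubmx Y) =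
   \rank (ciM Y' Y) + \rank (usubmx Y'))%N.
Proof.
move=> fY fY'; have := etrans (rank_ciM Y' fY) (esym (rank_ciM Y fY')).
by rewrite capmxC => /addIn.
Qed.

Lemma ciM_mul0 k Y Y' (H G : 'M_(n, k)) : frame Y ->
  usubmx Y *m H = usubmx Y' *m G -> ciM Y Y' *m G = 0.
Proof.
move=> fY HG; rewrite ciME mulNmx -!mulmxA -HG [X in _ *m X]mulmxA.
by rewrite -frame_sym // !mulmxA ker_proj_mul_tr !mul0mx oppr0.
Qed.

(** Converse of [ciM_mul0]: on the kernel of [M] the equation [X a = X' c] is solved by the
    pseudoinverse. *)
Lemma ciT_lift Y Y' : frame Y ->
  usubmx Y *m (MPinv (usubmx Y) *m usubmx Y' *m ciT Y Y') =
  usubmx Y' *m ciT Y Y'.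
Proof.
move=> fY; set X := usubmx Y.
have /and4P[/eqP XX _ _ _] := MPinvP X.
(* The rows of this projector annihilate [X], so they are combinations of those of [E U^T]; times
   [X' T] they give a multiple of [M T = 0]. *)
have [D FE] : exists D, 1%:M - X *m MPinv X =
    D *m ((1%:M - MPinv X *m X) *m (dsubmx Y)^T).
  apply/submxP; rewrite (frame_ker_eqmx fY); apply/sub_kermxP.
  by rewrite mulmxBl mul1mx XX subrr.
apply/esym/eqP; rewrite -subr_eq0 !mulmxA -mulmxBl -{1}[usubmx Y']mul1mx -mulmxBl.
rewrite FE -[D *m _ *m _]mulmxA -[D *m _ *m _]mulmxA.
rewrite -[X in D *m (X *m _)]opprK -ciME mulNmx mulmx_ker_proj.
by rewrite oppr0 mulmx0.
Qed.

(** [T] fixes [G] and [G2], and [M G2 = 0] says that [MPinv X *m X] fixes [w G2]; inserting this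
    projector after [H^T] turns [X H] into [X' G]. The bilinear form serves [rank_wronsk]. *)
Lemma ciP_form k l Y Y' (H G : 'M_(n, k)) (G2 : 'M_(n, l)) :
  usubmx Y *m H = usubmx Y' *m G ->
  ciM Y Y' *m G = 0 -> ciM Y Y' *m G2 = 0 ->
  H^T *m wronsk Y Y' *m G2 = G^T *m (ciP Y Y')^T *m G2.
Proof.
move=> HG /ker_proj_id TG MG2; have TG2 : ciT Y Y' *m G2 = G2 := ker_proj_id MG2.
have TT : (ciT Y Y')^T = ciT Y Y' by apply: ker_proj_sym.
have TGt : G^T *m ciT Y Y' = G^T by rewrite -{2}TG trmx_mul ker_proj_sym.
have wG : (MPinv (usubmx Y) *m usubmx Y)^T *m (wronsk Y Y' *m G2) =
    wronsk Y Y' *m G2.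
  have /and4P[_ _ _ /eqP ->] := MPinvP (usubmx Y).
  apply/esym/eqP; rewrite -subr_eq0 -{1}[wronsk _ _ *m G2]mul1mx -mulmxBl.
  by rewrite mulmxA MG2.
rewrite /ciP; move: (wronsk Y Y') (ciT Y Y') wG TT TGt TG2 => w T wG TT TGt TG2.
rewrite !trmx_mul trmxK TT !mulmxA TGt -(mulmxA _ T G2) TG2 -(mulmxA H^T) -wG trmx_mul.
by rewrite !mulmxA -trmx_mul HG trmx_mul.
Qed.

Lemma ciM_mulT Y Y' : ciM Y Y' *m ciT Y Y' = 0.
Proof. exact: mulmx_ker_proj. Qed.

(** The two terms of [w] become [G^T X'^T U' G] and [H^T U^T X H], each symmetric by a frame
    condition. *)
Lemma wronsk_form_sym k Y Y' (H G : 'M_(n, k)) : frame Y -> frame Y' ->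
  usubmx Y *m H = usubmx Y' *m G ->
  (H^T *m wronsk Y Y' *m G)^T = H^T *m wronsk Y Y' *m G.
Proof.
move=> fY fY' HG; rewrite wronskE mulmxBr mulmxBl linearB /=.
congr (_ - _).
  rewrite !mulmxA -trmx_mul HG !trmx_mul !trmxK -!mulmxA.
  by rewrite [X in _ *m X]mulmxA -frame_sym // !mulmxA.
rewrite -!mulmxA -HG !trmx_mul !trmxK -!mulmxA.
by rewrite [X in _ *m X]mulmxA frame_sym // !mulmxA.
Qed.

Lemma ciP_lift Y Y' : frame Y -> frame Y' ->
  exists2 H : 'M_n, usubmx Y *m H = usubmx Y' *m ciT Y Y' &
    H^T *m wronsk Y Y' *m ciT Y Y' = ciP Y Y'.
Proof.
move=> fY fY'; set H := MPinv (usubmx Y) *m usubmx Y' *m ciT Y Y'.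
have HT : usubmx Y *m H = usubmx Y' *m ciT Y Y' by apply: ciT_lift.
exists H => //; rewrite -(wronsk_form_sym fY fY' HT) /ciP /H.
by rewrite !trmx_mul !trmxK ker_proj_sym !mulmxA.
Qed.

Lemma ciP_sym Y Y' : frame Y -> frame Y' -> (ciP Y Y')^T = ciP Y Y'.
Proof.
move=> fY fY'; have [H HT <-] := ciP_lift fY fY'.
exact: wronsk_form_sym.
Qed.

(* The intrinsic description of P: its value at c is w(Y a, Y' c) whenever
   X a = X' c. *)
Lemma ciP_congr k Y Y' (H G : 'M_(n, k)) : frame Y -> frame Y' ->
  usubmx Y *m H = usubmx Y' *m G ->
  H^T *m wronsk Y Y' *m G = G^T *m ciP Y Y' *m G.
Proof.
move=> fY fY' HG; have MG := ciM_mul0 fY HG.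
by rewrite (ciP_form HG) // ciP_sym.
Qed.

(** The lift [H] of [T] also solves the swapped equation, so [P(Y, Y') = - H^T P(Y', Y) H]. As [H]
    may be singular, this gives inequalities only. *)
Lemma ind_ciP_swap_le Y Y' : frame Y -> frame Y' ->
  (ind (ciP Y Y') <= ind (- ciP Y' Y))%N /\ (ind (- ciP Y Y') <= ind (ciP Y' Y))%N.
Proof.
move=> fY fY'; have [H HT PE] := ciP_lift fY fY'.
have PE' : ciP Y Y' = - (H^T *m ciP Y' Y *m H).
  rewrite -(ciP_congr fY' fY (esym HT)) -[wronsk Y' Y]opprK -wronsk_tr.
  rewrite mulmxN mulNmx opprK -{1}ciP_sym // -PE.
  by rewrite [LHS]trmx_mul [X in _ *m X]trmx_mul trmxK mulmxA.
have sP := ciP_sym fY' fY.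
split; last by rewrite PE' opprK; apply: ind_congr.
by rewrite PE' -mulNmx -mulmxN; apply: ind_congr; rewrite linearN /= sP.
Qed.

Lemma ind_ciP_swap Y Y' : frame Y -> frame Y' -> ind (ciP Y Y') = ind (- ciP Y' Y).
Proof.
move=> fY fY'; apply/eqP; rewrite eqn_leq.
by rewrite (ind_ciP_swap_le fY fY').1 (ind_ciP_swap_le fY' fY).2.
Qed.

(** The pair [(C^-1 H, C'^-1 T)] solves the equation of the scaled frames and gives the form the
    same value. *)
Lemma ciP_scale_congr Y Y' C C' : frame Y -> frame Y' ->
    C \in unitmx -> C' \in unitmx ->
  exists L : 'M_n, ciP Y Y' = L^T *m ciP (Y *m C) (Y' *m C') *m L.
Proof.
move=> fY fY' Cu Cu'; have [H HT PE] := ciP_lift fY fY'.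
exists (invmx C' *m ciT Y Y').
rewrite -(@ciP_congr _ _ _ (invmx C *m H)); [|exact: frameM..|].
  rewrite wronskM -PE trmx_mul trmx_inv !mulmxA.
  by rewrite mulmxKV ?unitmx_tr // mulmxK.
by rewrite !mul_usub_mx !mulmxA !mulmxK // -!mul_usub_mx.
Qed.

Lemma ind_ciP_scale_le Y Y' C C' : frame Y -> frame Y' ->
    C \in unitmx -> C' \in unitmx ->
  (ind (ciP Y Y') <= ind (ciP (Y *m C) (Y' *m C')))%N /\
  (ind (- ciP Y Y') <= ind (- ciP (Y *m C) (Y' *m C')))%N.
Proof.
move=> fY fY' Cu Cu'; have [L ->] := ciP_scale_congr fY fY' Cu Cu'.
have sP := ciP_sym (frameM Cu fY) (frameM Cu' fY').
split; first exact: ind_congr.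
by rewrite -mulNmx -mulmxN; apply: ind_congr; rewrite linearN /= sP.
Qed.

Lemma ind_ciP_scale Y Y' C C' : frame Y -> frame Y' ->
    C \in unitmx -> C' \in unitmx ->
  ind (ciP (Y *m C) (Y' *m C')) = ind (ciP Y Y') /\
  ind (- ciP (Y *m C) (Y' *m C')) = ind (- ciP Y Y').
Proof.
move=> fY fY' Cu Cu'; have [le1 le2] := ind_ciP_scale_le fY fY' Cu Cu'.
(* Scaling back by the inverses gives the reverse inequalities. *)
have Ci : invmx C \in unitmx by rewrite unitmx_inv.
have Ci' : invmx C' \in unitmx by rewrite unitmx_inv.
have := ind_ciP_scale_le (frameM Cu fY) (frameM Cu' fY') Ci Ci'.
rewrite (mulmxK Cu) (mulmxK Cu') => -[ge1 ge2].
split; apply/eqP; rewrite eqn_leq; apply/andP; split;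
  [exact: ge1 | exact: le1 | exact: ge2 | exact: le2].
Qed.

Lemma rank_ciM_scale Y Y' C C' : frame Y -> frame Y' ->
    C \in unitmx -> C' \in unitmx ->
  \rank (ciM (Y *m C) (Y' *m C')) = \rank (ciM Y Y').
Proof.
move=> fY fY' Cu Cu'.
have kerM (Z : 'M[R]_(n + n, n)) (D : 'M_n) : D \in unitmx ->
    (kermx (usubmx (Z *m D)) :=: kermx (usubmx Z))%MS.
  move=> Du; apply/eqmxP/andP; split; apply/sub_kermxP.
    by apply: (can_inj (mulmxK Du)); rewrite -mulmxA mul_usub_mx mulmx_ker mul0mx.
  by rewrite -mul_usub_mx mulmxA mulmx_ker mul0mx.
have := etrans (rank_ciM (Y' *m C') (frameM Cu fY)) (esym (rank_ciM Y' fY)).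
rewrite (cap_eqmx (kerM Y _ Cu) (kerM Y' _ Cu')) -mul_usub_mx.
by rewrite (mxrankMfree (usubmx Y)) ?row_free_unit // => /addIn /addIn.
Qed.

Lemma mu_scale Y Y' C C' : frame Y -> frame Y' ->
    C \in unitmx -> C' \in unitmx ->
  mu (Y *m C) (Y' *m C') = mu Y Y' /\ mu_dual (Y *m C) (Y' *m C') = mu_dual Y Y'.
Proof.
move=> fY fY' Cu Cu'; rewrite /mu /mu_dual (rank_ciM_scale fY fY' Cu Cu').
by have [-> ->] := ind_ciP_scale fY fY' Cu Cu'.
Qed.

Lemma mu_swap Y Y' : frame Y -> frame Y' ->
  (mu Y Y' + \rank (usubmx Y) = mu_dual Y' Y + \rank (usubmx Y'))%N.
Proof.
move=> fY fY'; rewrite /mu /mu_dual addnAC (rank_ciM_sym fY fY').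
by rewrite ind_ciP_swap // addnAC.
Qed.

(* The form w on pairs (a, c) satisfies w(ker X, ker X') = 0, with
   ker M(Y, Y') = (ker X)^perp and ker M(Y', Y) = (ker X')^perp; restricting to these
   two orthogonals loses exactly the ranks of the two M's and leaves a form of the
   rank of P. *)
Lemma rank_wronsk Y Y' : frame Y -> frame Y' -> \rank (wronsk Y Y') =
  (\rank (ciM Y Y') + \rank (ciM Y' Y) + \rank (ciP Y Y'))%N.
Proof.
move=> fY fY'; set w := wronsk Y Y'; set T := ciT Y Y'; set T' := ciT Y' Y.
set E := 1%:M - MPinv (usubmx Y) *m usubmx Y.
set E' := 1%:M - MPinv (usubmx Y') *m usubmx Y'.
have trE : E^T = E by apply: ker_proj_sym.
have trE' : E'^T = E' by apply: ker_proj_sym.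
have trT : T^T = T by apply: ker_proj_sym.
have ME : (ciM Y Y')^T = w^T *m E by rewrite /ciM trmx_mul -/E trE.
have ME' : (ciM Y' Y)^T = - (w *m E').
  by rewrite /ciM trmx_mul -/E' trE' wronsk_tr mulNmx.
have rw : \rank w = (\rank (ciM Y Y') + \rank (w *m T))%N.
  rewrite -mxrank_tr (@rank_ker_mul _ _ _ _ _ T _ E).
    by rewrite -ME mxrank_tr -[\rank (T *m _)]mxrank_tr trmx_mul trmxK trT.
  by rewrite -ME; apply: ker_proj_eqmx.
(* A column [c] of [E'] satisfies [X' c = 0 = X 0], so it lies in the kernel of [M]. *)
have TE' : T *m E' = E'.
  apply: ker_proj_id; apply: (@ciM_mul0 _ _ _ 0) => //.
  by rewrite mulmx0 mulmx_ker_proj.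
have rwT : \rank (w *m T) = (\rank (ciM Y' Y) + \rank (T' *m (w *m T)))%N.
  have wTE' : w *m T *m (- E') = (ciM Y' Y)^T by rewrite mulmxN -mulmxA TE' ME'.
  rewrite (@rank_ker_mul _ _ _ _ _ T' _ (- E')) wTE' ?mxrank_tr //.
  exact: ker_proj_eqmx.
(* Each form factors through the other: [T' w T = G^T P T] and [P = H^T T' w T]. *)
rewrite rw rwT addnA; congr (_ + _)%N; apply/eqP; rewrite eqn_leq; apply/andP; split.
  have [G GT _] := ciP_lift fY' fY.
  have trT' : T'^T = T' by apply: ker_proj_sym.
  rewrite mulmxA -{1}trT' (ciP_form (esym GT)) ?ciM_mulT ?(ciM_mul0 fY (esym GT)) //.
  by rewrite ciP_sym // (leq_trans (mxrankM_maxl _ _)) ?mxrankM_maxr.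
have [H HT <-] := ciP_lift fY fY'.
have T'H : T' *m H = H by apply/ker_proj_id/(ciM_mul0 fY' (esym HT)).
rewrite -T'H trmx_mul [T'^T]ker_proj_sym -!mulmxA; exact: mxrankM_maxr.
Qed.

Lemma mu_add_dual Y Y' : frame Y -> frame Y' ->
  (mu Y Y' + mu_dual Y Y' + \rank (usubmx Y) =
   \rank (wronsk Y Y') + \rank (usubmx Y'))%N.
Proof.
move=> fY fY'; have := rank_ciM_sym fY fY'.
rewrite rank_wronsk // (rank_ind (ciP_sym fY fY')) /mu /mu_dual; lia.
Qed.

End ComparativeForm.

(** * Cyclic and open sums over a sequence *)

Lemma zip_rot (S T : Type) j (s : seq S) (t : seq T) : size s = size t ->
  zip (rot j s) (rot j t) = rot j (zip s t).
Proof.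
move=> st; have [js|js] := leqP j (size s); last first.
  rewrite !rot_oversize ?size1_zip -?st //; exact: ltnW.
rewrite -{2}(cat_take_drop j s) -{2}(cat_take_drop j t).
rewrite !zip_cat ?size_drop ?size_takel -?st //.
rewrite -[X in rot X](size_takel js) -(size1_zip (t := take j t)).
  by rewrite rot_size_cat.
by rewrite !size_takel -?st.
Qed.

Section CyclicSum.
Variables (V : zmodType) (f : V -> V -> int) (r : V -> int).
Implicit Types s t : seq V.

(** The common shape of [mu_c_minus] and [mu_c_plus], which are instances by conversion. *)
Definition cyclic_sum (F : V -> V -> int) s : int :=
  \sum_(0 <= k < (size s).-1) F s`_k s`_k.+1 + F s`_(size s).-1 s`_0.

Definition open_sum (F : V -> V -> int) s : int :=
  \sum_(0 <= k < (size s).-1) F s`_k s`_k.+1 - F s`_0 s`_(size s).-1.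

(** Pairing [s] with its rotation absorbs the closing term, so rotations and reversals merely
    permute a list of pairs. *)
Lemma cyclic_sum_zip s : (0 < size s)%N ->
  cyclic_sum f s = \sum_(p <- zip s (rot 1 s)) f p.1 p.2.
Proof.
case: s => [|x s] // _; rewrite /cyclic_sum rot1_cons (big_nth (0, 0)) size_zip.
rewrite size_rcons minnn [size _]/= big_nat_recr //= nth_zip ?size_rcons //=.
rewrite nth_rcons ltnn eqxx; congr (_ + _).
rewrite !big_nat; apply: eq_bigr => k /andP[_ ks].
by rewrite nth_zip ?size_rcons //= nth_rcons ks.
Qed.

(** Reduces open sums to cyclic ones, at the cost of the closing edge in both orientations. *)
Lemma open_sumE s : open_sum f s =
  cyclic_sum f s - (f s`_(size s).-1 s`_0 + f s`_0 s`_(size s).-1).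
Proof. by rewrite opprD addrA addrK. Qed.

Lemma mem_zip_rot s p : p \in zip s (rot 1 s) -> p.1 \in s /\ p.2 \in s.
Proof.
move=> ps; have /= := (map_f fst ps, map_f snd ps).
rewrite -/(unzip1 _) -/(unzip2 _) unzip1_zip ?unzip2_zip ?size_rot //.
by rewrite mem_rot => -[].
Qed.

(** Both components run through the same multiset, so the differences of [r] cancel. *)
Lemma sum_zip_rot_coboundary (F : V * V -> int) s :
  \sum_(p <- zip s (rot 1 s)) (F p + (r p.2 - r p.1)) =
  \sum_(p <- zip s (rot 1 s)) F p.
Proof.
rewrite big_split sumrB -(big_map snd xpredT r) -(big_map fst xpredT r) /=.
rewrite -/(unzip1 _) -/(unzip2 _) unzip1_zip ?unzip2_zip ?size_rot //.
by rewrite (perm_big s) ?subrr ?addr0 //= perm_rot.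
Qed.

Lemma eq_cyclic_sum s t : (0 < size s)%N -> size t = size s ->
    (forall i j, (i < size s)%N -> (j < size s)%N -> f t`_i t`_j = f s`_i s`_j) ->
  cyclic_sum f t = cyclic_sum f s /\ open_sum f t = open_sum f s.
Proof.
move=> s0 ts fts; rewrite /cyclic_sum /open_sum ts.
have l0 : ((size s).-1 < size s)%N by rewrite prednK.
rewrite !(fts _ _ s0 l0) !(fts _ _ l0 s0); split; congr (_ + _);
  by apply: eq_big_nat => k /andP[_ ks]; rewrite fts //; lia.
Qed.

Lemma cyclic_sum_rotr j s : (0 < size s)%N ->
  cyclic_sum f (rotr j s) = cyclic_sum f s.
Proof.
move=> s0; rewrite !cyclic_sum_zip ?size_rotr // /rotr rot_rot zip_rot ?size_rot //.
by apply: perm_big; rewrite perm_rot.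
Qed.

End CyclicSum.

Section CyclicSumSwap.
Variables (V : zmodType) (f g h : V -> V -> int) (r : V -> int) (s : seq V).
Hypothesis s_gt0 : (0 < size s)%N.
Let x0 := s`_0.
Let xl := s`_(size s).-1.

Let x0s : x0 \in s. Proof. exact: mem_nth. Qed.
Let xls : xl \in s. Proof. by rewrite mem_nth // prednK. Qed.

Section Reversal.
Hypothesis fg : {in s &, forall x y, f x y = g y x + (r y - r x)}.

Lemma cyclic_sum_rev : cyclic_sum f s = cyclic_sum g (rev s).
Proof.
rewrite !cyclic_sum_zip ?size_rev // -rev_rotr -rev_zip ?size_rotr //.
transitivity (\sum_(p <- zip s (rot 1 s)) g p.2 p.1).
  rewrite -(sum_zip_rot_coboundary r (fun p => g p.2 p.1)) !big_seq.
  by apply: eq_bigr => p /mem_zip_rot[]; apply: fg.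
transitivity (\sum_(p <- zip (rot 1 s) s) g p.1 p.2).
  elim: (s) (rot 1 s) => [|x t IH] [|y u] //=; rewrite ?big_nil //.
  by rewrite !big_cons IH.
(* Up to reversal the pairs are those of [zip s (rotr 1 s)]; one rotation turns this into
   [zip (rot 1 s) s]. *)
apply: perm_big; rewrite perm_sym perm_rev -(perm_rot 1) -zip_rot ?size_rotr //.
by rewrite rotrK.
Qed.

Lemma open_sum_rev : open_sum f s = open_sum g (rev s).
Proof.
rewrite !open_sumE size_rev cyclic_sum_rev !nth_rev ?prednK // subnn subn1.
(* Over the two orientations of the closing edge the differences of [r] cancel. *)
rewrite -/x0 -/xl (fg xls x0s) (fg x0s xls); lia.
Qed.

End Reversal.

Section Sum.
Hypothesis fgh : {in s &, forall x y, f x y + g x y = h x y + (r y - r x)}.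
Hypothesis h_sym : {in s &, forall x y, h x y = h y x}.

Lemma cyclic_sum_add : cyclic_sum f s + cyclic_sum g s = cyclic_sum h s.
Proof.
rewrite !cyclic_sum_zip // -big_split -(sum_zip_rot_coboundary r) !big_seq.
by apply: eq_bigr => p /mem_zip_rot[]; apply: fgh.
Qed.

(** The closing term runs from last to first; the symmetry of [h] identifies it with that of
    [open_sum h]. *)
Lemma open_sum_add : open_sum f s + open_sum g s =
  \sum_(0 <= k < (size s).-1) h s`_k s`_k.+1 - h xl x0.
Proof.
rewrite (h_sym xls x0s) -/(open_sum h s) !open_sumE -cyclic_sum_add -/x0 -/xl.
have := fgh xls x0s; have := fgh x0s xls; lia.
Qed.

End Sum.
End CyclicSumSwap.

(** * The cyclic sums of comparative indices, with [rank X] as the potential [r] *)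

Section CyclicIndices.
Variables (R : rcfType) (n : nat).
Implicit Type s : seq 'M[R]_(n + n, n).

Let muZ (A B : 'M[R]_(n + n, n)) := (mu A B)%:Z.
Let mudZ (A B : 'M[R]_(n + n, n)) := (mu_dual A B)%:Z.
Let rkZ (A B : 'M[R]_(n + n, n)) := (\rank (wronsk A B))%:Z.
Let rkX (A : 'M[R]_(n + n, n)) := (\rank (usubmx A))%:Z.

Lemma cyclic_indices_scale s t : (0 < size s)%N -> size t = size s ->
    (forall i, (i < size s)%N -> frame s`_i) ->
    (forall i, (i < size s)%N -> exists2 C, C \in unitmx & t`_i = s`_i *m C) ->
  [/\ mu_c_minus s = mu_c_minus t, mu_c_plus s = mu_c_plus t,
      nu_c_minus s = nu_c_minus t & nu_c_plus s = nu_c_plus t].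
Proof.
move=> s0 ts fs tC.
have muts i j : (i < size s)%N -> (j < size s)%N ->
    muZ t`_i t`_j = muZ s`_i s`_j /\ mudZ t`_i t`_j = mudZ s`_i s`_j.
  move=> si sj; have [C Cu ->] := tC i si; have [D Du ->] := tC j sj.
  by rewrite /muZ /mudZ; have [-> ->] := mu_scale (fs i si) (fs j sj) Cu Du.
have [c1 o1] := eq_cyclic_sum s0 ts (fun i j si sj => (muts i j si sj).1).
have [c2 o2] := eq_cyclic_sum s0 ts (fun i j si sj => (muts i j si sj).2).
by split; [exact: (esym c1) | exact: (esym c2) | exact: (esym o1) | exact: (esym o2)].
Qed.

Lemma mu_c_rotr j s : (0 < size s)%N ->
  mu_c_minus s = mu_c_minus (rotr j s) /\ mu_c_plus s = mu_c_plus (rotr j s).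
Proof.
by move=> s0; split; [exact: (esym (cyclic_sum_rotr muZ j s0))
                     | exact: (esym (cyclic_sum_rotr mudZ j s0))].
Qed.

Lemma cyclic_indices_rev s : (0 < size s)%N -> {in s, forall A, frame A} ->
  mu_c_minus s = mu_c_plus (rev s) /\ nu_c_minus s = nu_c_plus (rev s).
Proof.
move=> s0 fs.
have swap : {in s &, forall A B, muZ A B = mudZ B A + (rkX B - rkX A)}.
  move=> A B /fs fA /fs fB; have := mu_swap fA fB; rewrite /muZ /mudZ /rkX; lia.
by split; [exact: (cyclic_sum_rev s0 swap) | exact: (open_sum_rev s0 swap)].
Qed.

Lemma cyclic_indices_dual_rev s : (0 < size s)%N -> {in s, forall A, frame A} ->
  mu_c_plus s = mu_c_minus (rev s) /\ nu_c_plus s = nu_c_minus (rev s).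
Proof.
move=> s0 fs; have [|A|-> ->] := @cyclic_indices_rev (rev s).
- by rewrite size_rev.
- by rewrite mem_rev; apply: fs.
by rewrite revK.
Qed.

Lemma cyclic_indices_add s : (0 < size s)%N -> {in s, forall A, frame A} ->
  mu_c_minus s + mu_c_plus s =
    \sum_(0 <= j < (size s).-1) (\rank (wronsk s`_j s`_j.+1))%:Z
    + (\rank (wronsk s`_(size s).-1 s`_0))%:Z /\
  nu_c_minus s + nu_c_plus s =
    \sum_(0 <= j < (size s).-1) (\rank (wronsk s`_j s`_j.+1))%:Z
    - (\rank (wronsk s`_(size s).-1 s`_0))%:Z.
Proof.
move=> s0 fs.
have add : {in s &, forall A B, muZ A B + mudZ A B = rkZ A B + (rkX B - rkX A)}.
  move=> A B /fs fA /fs fB; have := mu_add_dual fA fB.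
  rewrite /muZ /mudZ /rkX /rkZ; lia.
have sym : {in s &, forall A B, rkZ A B = rkZ B A}.
  by move=> A B _ _; rewrite /rkZ -mxrank_tr wronsk_tr mxrank_opp.
by split; [exact: (cyclic_sum_add s0 add) | exact: (open_sum_add s0 add sym)].
Qed.

End CyclicIndices.

Theorem proposition2p3 (R : realType) (n m : nat) (hm : (2 <= m)%N)
    (Y : m.-tuple 'M[R]_(n + n, n)) (hY : forall i : 'I_m, frame (tnth Y i)) :
  (* (i) *)
  (forall C : 'I_m -> 'M[R]_n, (forall i, C i \in unitmx) ->
    let YC := [tuple tnth Y i *m C i | i < m] in
    [/\ mu_c_minus Y = mu_c_minus YC,
        mu_c_plus Y = mu_c_plus YC,
        nu_c_minus Y = nu_c_minus YC
      & nu_c_plus Y = nu_c_plus YC]) /\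
  (* (ii) *)
  (forall j : nat, (j < m)%N ->
    mu_c_minus Y = mu_c_minus (rotr j Y) /\
    mu_c_plus Y = mu_c_plus (rotr j Y)) /\
  (* (iii) *)
  [/\ mu_c_minus Y = mu_c_plus (rev Y),
      mu_c_plus Y = mu_c_minus (rev Y),
      nu_c_minus Y = nu_c_plus (rev Y)
    & nu_c_plus Y = nu_c_minus (rev Y)] /\
  (* (iv) *)
  mu_c_minus Y + mu_c_plus Y =
    \sum_(0 <= j < m.-1) (\rank (wronsk Y`_j Y`_j.+1))%:Z
    + (\rank (wronsk Y`_m.-1 Y`_0))%:Z /\
  nu_c_minus Y + nu_c_plus Y =
    \sum_(0 <= j < m.-1) (\rank (wronsk Y`_j Y`_j.+1))%:Z
    - (\rank (wronsk Y`_m.-1 Y`_0))%:Z.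
Proof.
have szY : size Y = m by rewrite size_tuple.
have Y0 : (0 < size Y)%N by rewrite szY ltnW.
have fY : {in tval Y, forall A, frame A} by move=> A /tnthP[i ->].
split=> [C Cu YC|]; last split=> [j _|]; last split.
- apply: (cyclic_indices_scale Y0) => [|i /(mem_nth 0)/fY //|i].
    by rewrite !size_tuple.
  rewrite szY => im; exists (C (Ordinal im)) => //.
  by rewrite -(tnth_nth 0 YC (Ordinal im)) tnth_mktuple (tnth_nth 0).
- exact: mu_c_rotr.
- have [rm nm] := cyclic_indices_rev Y0 fY.
  have [rp np] := cyclic_indices_dual_rev Y0 fY; exact: And4 rm rp nm np.
by have := cyclic_indices_add Y0 fY; rewrite szY.
Qed.
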